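(* Let $n \geq 2$ be a natural number and let $A$ be a not necessarily unital $\mathbb{Q}(n-1)$-algebra. Then there is a natural (in $A$) isomorphism of abelian groups $$K_0^n(A) \cong \bigl(K_0(A)\bigr)^{n-1}.$$
   Context: $\mathbb{Q}(n-1)\subset\mathbb{C}$ is the cyclotomic field obtained by adjoining the primitive root of unity $e^{2\pi i/(n-1)}$ to $\mathbb{Q}$. An $n$-potent in a ring $R$ is an element $e$ with $e^n=e$. For a unital ring $R$, let $M_\infty(R)=\bigcup_k M_k(R)$, the direct limit under $a\mapsto \mathrm{diag}(a,0)$, and let $\mathcal{P}^n_\infty(R)$ be the set of $n$-potents in $M_\infty(R)$. For $e,f\in\mathcal{P}^n_\infty(R)$ write $e\sim f$ if, for $k$ large enough that $e,f\in M_k(R)$, there are $a,b\in M_k(R)$ with $e=ab$ and $f=ba$. Let $\mathcal{V}^n(R)$ be the set of equivalence classes, an abelian monoid under $[e]+[f]=[\mathrm{diag}(e,f)]$ with identity $[0]$. The group $K_0^n(R)$ is the Grothendieck completion of $\mathcal{V}^n(R)$. For $n=2$ this is the usual $K_0(R)$ defined by idempotents. A unital ring homomorphism $\alpha:R\to S$ induces a group homomorphism $\alpha_*:K_0^n(R)\to K_0^n(S)$, $[(a_{ij})]\mapsto[(\alpha(a_{ij}))]$. For a nonunital $\mathbb{Q}(n-1)$-algebra $A$, let $A^+=\{(a,\lambda):a\in A,\lambda\in\mathbb{Q}(n-1)\}$ be its unitization, with componentwise addition and scalar multiplication and product $(a,\lambda)(b,\tau)=(ab+a\tau+b\lambda,\lambda\tau)$.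 Let $\pi:A^+\to\mathbb{Q}(n-1)$, $\pi(a,\lambda)=\lambda$. Then $K_0^n(A):=\ker\bigl(\pi_*:K_0^n(A^+)\to K_0^n(\mathbb{Q}(n-1))\bigr)$, and likewise $K_0(A)$ is the kernel of $\pi_*:K_0(A^+)\to K_0(\mathbb{Q}(n-1))$. (If $A$ is already unital, this kernel is naturally isomorphic to the group defined directly.) *)

(* Defs.v *)
From HB Require Import structures.
From mathcomp Require Import all_boot all_order all_algebra.
From mathcomp Require Import complex.
From mathcomp Require Import boolp reals trigo.

Set Implicit Arguments.
Unset Strict Implicit.
Unset Printing Implicit Defensive.

Import Order.TTheory GRing.Theory Num.Theory.
Local Open Scope ring_scope.
Local Open Scope quotient_scope.

Section Cyclotomic.
Variables (R : realType) (m : nat).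

(* e^(2 i pi / m) *)
Definition root_of_unity : R[i] :=
  Complex (cos (2 * pi / m%:R)) (sin (2 * pi / m%:R)).

(* The smallest subfield of R[i] containing root_of_unity; as every subfield
   contains the rationals, this is what adjoining the root to them yields. *)
Definition cyclotomic : {pred R[i]} := fun x =>
  `[< forall S : {pred R[i]},
        divring_closed S -> root_of_unity \in S -> x \in S >].

Lemma cyclotomic_divring_closed : divring_closed cyclotomic.
Proof.
split; first by apply/asboolP => S [].
- move=> x y /asboolP hx /asboolP hy; apply/asboolP => S hS hz.
  by have [_ h _] := hS; apply: h; [exact: hx|exact: hy].
- move=> x y /asboolP hx /asboolP hy; apply/asboolP => S hS hz.
  by have [_ _ h] := hS; apply: h; [exact: hx|exact: hy].
Qed.

HB.instance Definition _ :=
  GRing.isDivringClosed.Build R[i] cyclotomic cyclotomic_divring_closed.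

Definition Qcyc := {x : R[i] | x \in cyclotomic}.

HB.instance Definition _ := SubChoice.on Qcyc.
HB.instance Definition _ := [SubChoice_isSubIntegralDomain of Qcyc by <:].
HB.instance Definition _ := [SubIntegralDomain_isSubField of Qcyc by <:].

End Cyclotomic.

Definition stabilize (R : pzRingType) (k m : nat) (le_km : (k <= m)%N)
    (a : 'M[R]_k) : 'M[R]_m :=
  castmx (subnKC le_km, subnKC le_km)
    (block_mx a 0 0 (0 : 'M[R]_(m - k))).

(* An n-potent of M_oo(R) is given by a representative in some M_k(R). Two
   representatives of the same element of the direct limit are identified by
   npot_equiv below (see npot_equiv_stabilize), so the quotient by npot_equiv
   of this type is the set of equivalence classes of n-potents of M_oo(R). *)
Definition npotent (n : nat) (R : pzRingType) :=
  {k : nat & {e : 'M[R]_k | e ^+ n == e}}.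

HB.instance Definition _ n R := Choice.on (npotent n R).

Section NPotent.
Variables (n : nat) (R : pzRingType).

Definition Npotent (k : nat) (e : 'M[R]_k) (eP : e ^+ n == e) : npotent n R :=
  Tagged (fun k => {e : 'M[R]_k | e ^+ n == e}) (exist _ e eP).

Definition npot_size (e : npotent n R) : nat := tag e.
Definition npot_mx (e : npotent n R) : 'M[R]_(npot_size e) := sval (tagged e).

Lemma npot_mxP (e : npotent n R) : npot_mx e ^+ n == npot_mx e.
Proof. exact: svalP (tagged e). Qed.

Definition npot_equiv (e f : npotent n R) : bool :=
  `[< exists m (he : (npot_size e <= m)%N) (hf : (npot_size f <= m)%N)
        (a b : 'M[R]_m),
        stabilize he (npot_mx e) = a *m b /\
        stabilize hf (npot_mx f) = b *m a >].

End NPotent.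

(* A size-independent form of the relation, used to show that it is an
   equivalence. *)
Section RectangularEquiv.
Variable R : pzRingType.

Definition rsim k l (e : 'M[R]_k) (f : 'M[R]_l) : Prop :=
  exists (a : 'M[R]_(k, l)) (b : 'M[R]_(l, k)), e = a *m b /\ f = b *m a.

Lemma mulmx_expC k l (a : 'M[R]_(k, l)) (b : 'M[R]_(l, k)) i :
  a *m (b *m a) ^+ i = (a *m b) ^+ i *m a.
Proof.
elim: i => [|i IH]; first by rewrite !expr0 mulmx1 mul1mx.
by rewrite exprSr [in RHS]exprSr -!mulmxE mulmxA IH !mulmxA.
Qed.

Lemma rsim_sym k l (e : 'M[R]_k) (f : 'M[R]_l) : rsim e f -> rsim f e.
Proof. by case=> a [b [-> ->]]; exists b, a. Qed.

Variable n : nat.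
Hypothesis n_gt1 : (1 < n)%N.

Lemma rsim_refl k (e : 'M[R]_k) : e ^+ n = e -> rsim e e.
Proof.
case: n n_gt1 => [|[|m]] // _ eP; exists e, (e ^+ m.+1).
by split; rewrite mulmxE -?exprS -?exprSr.
Qed.

Lemma rsim_trans k l p (e : 'M[R]_k) (f : 'M[R]_l) (g : 'M[R]_p) :
  e ^+ n = e -> g ^+ n = g -> rsim e f -> rsim f g -> rsim e g.
Proof.
case: n n_gt1 => [|[|m]] // _ eP gP [a [b [Ee Ef]]] [c [d [Ef' Eg]]].
exists (a *m c), ((d *m c) ^+ m *m d *m b); split.
  rewrite -eP exprSr Ee -mulmxE mulmxA -mulmx_expC -Ef Ef'.
  rewrite exprSr -mulmxE [_ *m (c *m d)]mulmxA -mulmx_expC.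
  by rewrite !mulmxA.
rewrite -gP Eg !exprSr -!mulmxE !mulmxA.
rewrite -[_ *m b *m a]mulmxA -Ef Ef'.
by rewrite !mulmxA.
Qed.

Lemma rsim_cast k l (E : k = l) (e : 'M[R]_k) (f : 'M[R]_l) :
  e ^+ n = e -> castmx (E, E) e = f -> rsim e f.
Proof. by case: l / E f => f eP; rewrite castmx_id => <-; exact: rsim_refl. Qed.

Lemma expmx_diag k l (e : 'M[R]_k) (f : 'M[R]_l) i :
  (block_mx e 0 0 f) ^+ i = block_mx (e ^+ i) 0 0 (f ^+ i).
Proof.
elim: i => [|i IH]; first by rewrite !expr0 -scalar_mx_block.
by rewrite !exprS IH -mulmxE mulmx_block !mulmx0 !mul0mx !addr0 !add0r.
Qed.

Lemma diag_npot k l (e : 'M[R]_k) (f : 'M[R]_l) :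
  e ^+ n = e -> f ^+ n = f -> (block_mx e 0 0 f) ^+ n = block_mx e 0 0 f.
Proof. by move=> eP fP; rewrite expmx_diag eP fP. Qed.

Lemma npot_castmx k l (E : k = l) (e : 'M[R]_k) :
  e ^+ n = e -> castmx (E, E) e ^+ n = castmx (E, E) e.
Proof. by case: l / E; rewrite castmx_id. Qed.

Lemma expr0n_gt1 k : (0 : 'M[R]_k) ^+ n = 0.
Proof. by case: n n_gt1 => // m _; rewrite exprS mul0r. Qed.

Lemma stabilize_npot k m (le_km : (k <= m)%N) (e : 'M[R]_k) :
  e ^+ n = e -> stabilize le_km e ^+ n = stabilize le_km e.
Proof. by move=> eP; apply/npot_castmx/diag_npot => //; exact: expr0n_gt1. Qed.

Lemma rsim_stabilize k m (le_km : (k <= m)%N) (e : 'M[R]_k) :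
  e ^+ n = e -> rsim e (stabilize le_km e).
Proof.
move=> eP; set d := block_mx e 0 0 (0 : 'M[R]_(m - k)).
have dP : d ^+ n = d by apply: diag_npot => //; exact: expr0n_gt1.
apply: (@rsim_trans _ _ _ e d) => //; first exact: stabilize_npot.
  have : rsim e e by exact: rsim_refl.
  case=> a [b [Ea Eb]]; exists (row_mx a 0), (col_mx b 0); split.
    by rewrite mul_row_col mulmx0 addr0.
  by rewrite mul_col_row !mulmx0 !mul0mx -Eb.
exact: (rsim_cast (E := subnKC le_km)).
Qed.

Lemma rsim_diag k l k' l' (e : 'M[R]_k) (f : 'M[R]_l)
    (e' : 'M[R]_k') (f' : 'M[R]_l') :
  rsim e e' -> rsim f f' -> rsim (block_mx e 0 0 f) (block_mx e' 0 0 f').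
Proof.
move=> [a [b [-> ->]]] [c [d [-> ->]]].
exists (block_mx a 0 0 c), (block_mx b 0 0 d).
by rewrite !mulmx_block !mulmx0 !mul0mx !addr0 !add0r.
Qed.

Lemma rsim_diagC k l (e : 'M[R]_k) (f : 'M[R]_l) :
  e ^+ n = e -> f ^+ n = f -> rsim (block_mx e 0 0 f) (block_mx f 0 0 e).
Proof.
move=> /rsim_refl [a [b [Ee Ee']]] /rsim_refl [c [d [Ef Ef']]].
exists (block_mx 0 a c 0), (block_mx 0 d b 0).
by rewrite !mulmx_block !mulmx0 !mul0mx !addr0 !add0r -Ee -Ee' -Ef -Ef'.
Qed.

Lemma rsim_diagA k l p (e : 'M[R]_k) (f : 'M[R]_l) (g : 'M[R]_p) :
  e ^+ n = e -> f ^+ n = f -> g ^+ n = g ->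
  rsim (block_mx e 0 0 (block_mx f 0 0 g))
       (block_mx (block_mx e 0 0 f) 0 0 g).
Proof.
move=> eP fP gP; apply: (rsim_cast (E := addnA k l p)).
  by apply: diag_npot => //; exact: diag_npot.
have := @block_mxA _ k l p k l p e 0 0 0 f 0 0 0 g.
by rewrite !row_mx0 !col_mx0 /= => ->; rewrite castmx_comp castmx_id.
Qed.

Lemma rsim_diag0 k (e : 'M[R]_k) :
  e ^+ n = e -> rsim (block_mx (0 : 'M[R]_0) 0 0 e) e.
Proof.
move=> /rsim_refl [a [b [Ee Ee']]]; exists (col_mx 0 a), (row_mx 0 b); split.
  by rewrite mul_col_row !mulmx0 !mul0mx -Ee.
by rewrite mul_row_col mulmx0 add0r.
Qed.

End RectangularEquiv.

Section VMonoid.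
Variables (n : nat) (n_gt1 : (1 < n)%N) (R : pzRingType).
Implicit Types e f g : npotent n R.

Lemma npot_equivP e f :
  reflect (rsim (npot_mx e) (npot_mx f)) (npot_equiv e f).
Proof.
have eP := eqP (npot_mxP e); have fP := eqP (npot_mxP f).
apply: (iffP (asboolP _)) => [[m [he [hf ab]]]|ef].
  have sef : rsim (stabilize he (npot_mx e)) (stabilize hf (npot_mx f)).
    by case: ab => a [b ?]; exists a, b.
  apply: (rsim_trans n_gt1) (rsim_stabilize n_gt1 he eP) _ => //.
  apply: (rsim_trans n_gt1) sef _ => //; first exact: stabilize_npot.
  exact/rsim_sym/(rsim_stabilize n_gt1).
exists (maxn (npot_size e) (npot_size f)), (leq_maxl _ _), (leq_maxr _ _).
rewrite -/(rsim _ _).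
apply: (rsim_trans n_gt1) (rsim_sym (rsim_stabilize n_gt1 _ eP)) _;
  do ?exact: stabilize_npot.
apply: (rsim_trans n_gt1) ef (rsim_stabilize n_gt1 _ fP) => //.
exact: stabilize_npot.
Qed.

Lemma npot_equiv_stabilize e m (le_em : (npot_size e <= m)%N)
    (eP : stabilize le_em (npot_mx e) ^+ n == stabilize le_em (npot_mx e)) :
  npot_equiv e (Npotent eP).
Proof. by apply/npot_equivP/(rsim_stabilize n_gt1)/eqP/npot_mxP. Qed.

Lemma npot_equiv_refl : reflexive (@npot_equiv n R).
Proof. by move=> e; apply/npot_equivP/(rsim_refl n_gt1)/eqP/npot_mxP. Qed.

Lemma npot_equiv_sym : symmetric (@npot_equiv n R).
Proof. by move=> e f; apply/npot_equivP/npot_equivP; apply: rsim_sym. Qed.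

Lemma npot_equiv_trans : transitive (@npot_equiv n R).
Proof.
move=> f e g /npot_equivP ef /npot_equivP fg; apply/npot_equivP.
by apply: (rsim_trans n_gt1) ef fg; apply/eqP/npot_mxP.
Qed.

Definition npot_equiv_rel : equiv_rel (npotent n R) :=
  EquivRel _ npot_equiv_refl npot_equiv_sym npot_equiv_trans.

Definition Vmonoid := {eq_quot npot_equiv_rel}.

HB.instance Definition _ := Choice.on Vmonoid.
HB.instance Definition _ := EqQuotient.on Vmonoid.

Definition Vclass e : Vmonoid := \pi_Vmonoid e.

Lemma Vclass_eqP e f :
  Vclass e = Vclass f <-> rsim (npot_mx e) (npot_mx f).
Proof.
by split=> [/eqmodP /npot_equivP //|/npot_equivP ef]; apply/eqmodP.
Qed.

Lemma VclassK (x : Vmonoid) : Vclass (repr x) = x.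
Proof. exact: reprK. Qed.

Fact npot_zero_subproof : (0 : 'M[R]_0) ^+ n == 0.
Proof. by rewrite expr0n_gt1. Qed.

Definition npot_zero : npotent n R := Npotent npot_zero_subproof.

Fact npot_diag_subproof e f :
  let d := block_mx (npot_mx e) 0 0 (npot_mx f) in d ^+ n == d.
Proof. by apply/eqP/diag_npot; apply/eqP/npot_mxP. Qed.

Definition npot_diag e f : npotent n R := Npotent (npot_diag_subproof e f).

Definition V_add (x y : Vmonoid) : Vmonoid :=
  Vclass (npot_diag (repr x) (repr y)).

Lemma V_addE e f : V_add (Vclass e) (Vclass f) = Vclass (npot_diag e f).
Proof. by apply/Vclass_eqP/rsim_diag; apply/Vclass_eqP/VclassK. Qed.

Lemma V_addA : associative V_add.
Proof.
move=> x y z; rewrite -[x]VclassK -[y]VclassK -[z]VclassK !V_addE.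
by apply/Vclass_eqP/(rsim_diagA n_gt1); apply/eqP/npot_mxP.
Qed.

Lemma V_addC : commutative V_add.
Proof.
move=> x y; rewrite -[x]VclassK -[y]VclassK !V_addE.
by apply/Vclass_eqP/(rsim_diagC n_gt1); apply/eqP/npot_mxP.
Qed.

Lemma V_add0 : left_id (Vclass npot_zero) V_add.
Proof.
move=> x; rewrite -[x]VclassK V_addE.
by apply/Vclass_eqP/(rsim_diag0 n_gt1); apply/eqP/npot_mxP.
Qed.

HB.instance Definition _ := GRing.isNmodule.Build Vmonoid V_addA V_addC V_add0.

Lemma VclassD e f : Vclass e + Vclass f = Vclass (npot_diag e f).
Proof. exact: V_addE. Qed.

Lemma Vclass0 : 0 = Vclass npot_zero.
Proof. by []. Qed.

End VMonoid.

Section VMap.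
Variables (n : nat) (n_gt1 : (1 < n)%N) (R S : pzRingType).
Variable alpha : {rmorphism R -> S}.

Lemma map_rsim k l (e : 'M[R]_k) (f : 'M[R]_l) :
  rsim e f -> rsim (map_mx alpha e) (map_mx alpha f).
Proof.
move=> [a [b [-> ->]]]; exists (map_mx alpha a), (map_mx alpha b).
by rewrite !map_mxM.
Qed.

Lemma map_mx_exp k (a : 'M[R]_k) i :
  map_mx alpha (a ^+ i) = map_mx alpha a ^+ i.
Proof.
elim: i => [|i IH]; first by rewrite !expr0 map_mx1.
by rewrite !exprS -!mulmxE map_mxM IH.
Qed.

Fact npot_map_subproof (e : npotent n R) :
  let d := map_mx alpha (npot_mx e) in d ^+ n == d.
Proof.
by rewrite /= -map_mx_exp (eqP (npot_mxP e)).
Qed.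

Definition npot_map (e : npotent n R) : npotent n S :=
  Npotent (npot_map_subproof e).

Definition V_map (x : Vmonoid n_gt1 R) : Vmonoid n_gt1 S :=
  Vclass n_gt1 (npot_map (repr x)).

Lemma V_mapE e : V_map (Vclass n_gt1 e) = Vclass n_gt1 (npot_map e).
Proof. by apply/Vclass_eqP/map_rsim/(Vclass_eqP n_gt1)/VclassK. Qed.

Lemma V_map_nmod_morphism : nmod_morphism V_map.
Proof.
split=> [|x y].
  rewrite Vclass0 V_mapE; apply/Vclass_eqP; rewrite /= /npot_mx /= map_mx0.
  exact/(rsim_refl n_gt1)/expr0n_gt1.
rewrite -[x]VclassK -[y]VclassK VclassD !V_mapE VclassD.
apply/Vclass_eqP; rewrite /npot_mx /= map_block_mx !map_mx0.
by apply: (rsim_refl n_gt1); apply: diag_npot; apply/eqP/npot_map_subproof.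
Qed.

HB.instance Definition _ :=
  GRing.isNmodMorphism.Build _ _ V_map V_map_nmod_morphism.

End VMap.

Section Grothendieck.
Variable M : nmodType.

Definition groth_equiv (p q : M * M) : bool :=
  `[< exists z, p.1 + q.2 + z = q.1 + p.2 + z >].

Lemma groth_equiv_refl : reflexive groth_equiv.
Proof. by move=> p; apply/asboolP; exists 0. Qed.

Lemma groth_equiv_sym : symmetric groth_equiv.
Proof. by move=> p q; apply/asboolP/asboolP => -[z ?]; exists z. Qed.

Lemma groth_equiv_trans : transitive groth_equiv.
Proof.
move=> [c d] [a b] [u v] /asboolP[/= z h1] /asboolP[/= w h2]; apply/asboolP.
exists (c + d + z + w) => /=.
transitivity (a + d + z + (c + v + w)); first by rewrite [LHS](AC (2*4) ((1*4*5)*(3*2*6))).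
by rewrite h1 h2 [LHS](AC (3*3) ((4*2)*(1*5*3*6))).
Qed.

Definition groth_equiv_rel : equiv_rel (M * M)%type :=
  EquivRel _ groth_equiv_refl groth_equiv_sym groth_equiv_trans.

Definition grothendieck := {eq_quot groth_equiv_rel}.

HB.instance Definition _ := Choice.on grothendieck.
HB.instance Definition _ := EqQuotient.on grothendieck.

(* The formal difference of a and b. *)
Definition groth_class (a b : M) : grothendieck := \pi_grothendieck (a, b).

Lemma groth_class_eqP a b c d :
  groth_class a b = groth_class c d <-> exists z, a + d + z = c + b + z.
Proof. by split=> [/eqmodP /asboolP //|h]; apply/eqmodP/asboolP. Qed.

Lemma groth_classK (x : grothendieck) :
  groth_class (repr x).1 (repr x).2 = x.
Proof. by rewrite /groth_class -surjective_pairing reprK. Qed.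

Lemma groth_classP (x : grothendieck) : exists a b, x = groth_class a b.
Proof. by exists (repr x).1, (repr x).2; rewrite groth_classK. Qed.

Definition groth_add (x y : grothendieck) : grothendieck :=
  groth_class ((repr x).1 + (repr y).1) ((repr x).2 + (repr y).2).

Definition groth_opp (x : grothendieck) : grothendieck :=
  groth_class (repr x).2 (repr x).1.

Lemma groth_addE a b c d :
  groth_add (groth_class a b) (groth_class c d) = groth_class (a + c) (b + d).
Proof.
have /groth_class_eqP[z h1] := groth_classK (groth_class a b).
have /groth_class_eqP[w h2] := groth_classK (groth_class c d).
apply/groth_class_eqP; exists (z + w).
set p := repr _ in h1 *; set q := repr _ in h2 *.
transitivity (p.1 + b + z + (q.1 + d + w)).
  by rewrite [LHS](AC (2*2*2) ((1*3*5)*(2*4*6))).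
by rewrite h1 h2 [LHS](AC (3*3) ((1*4)*(2*5)*(3*6))).
Qed.

Lemma groth_oppE a b : groth_opp (groth_class a b) = groth_class b a.
Proof.
have /groth_class_eqP[z h] := groth_classK (groth_class a b).
apply/groth_class_eqP; exists z.
by rewrite [_ + a]addrC -h addrC [_ + b]addrC addrC.
Qed.

Lemma groth_addA : associative groth_add.
Proof.
move=> x y z; have [a [b ->]] := groth_classP x.
have [c [d ->]] := groth_classP y; have [u [v ->]] := groth_classP z.
by rewrite !groth_addE !addrA.
Qed.

Lemma groth_addC : commutative groth_add.
Proof.
move=> x y; have [a [b ->]] := groth_classP x.
have [c [d ->]] := groth_classP y.
by rewrite !groth_addE [a + c]addrC [b + d]addrC.
Qed.

Lemma groth_add0 : left_id (groth_class 0 0) groth_add.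
Proof.
by move=> x; have [a [b ->]] := groth_classP x; rewrite groth_addE !add0r.
Qed.

Lemma groth_addN : left_inverse (groth_class 0 0) groth_opp groth_add.
Proof.
move=> x; have [a [b ->]] := groth_classP x.
rewrite groth_oppE groth_addE; apply/groth_class_eqP; exists 0.
by rewrite !addr0 add0r addrC.
Qed.

HB.instance Definition _ := GRing.isZmodule.Build grothendieck
  groth_addA groth_addC groth_add0 groth_addN.

Lemma groth_classD a b c d :
  groth_class a b + groth_class c d = groth_class (a + c) (b + d).
Proof. exact: groth_addE. Qed.

Lemma groth_classN a b : - groth_class a b = groth_class b a.
Proof. exact: groth_oppE. Qed.

Lemma groth_class0 : 0 = groth_class 0 0.
Proof. by []. Qed.

End Grothendieck.

Section GrothendieckMap.
Variables (M N : nmodType) (h : {additive M -> N}).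

Definition groth_map (x : grothendieck M) : grothendieck N :=
  groth_class (h (repr x).1) (h (repr x).2).

Lemma groth_mapE a b : groth_map (groth_class a b) = groth_class (h a) (h b).
Proof.
have /groth_class_eqP[z e] := groth_classK (groth_class a b).
by apply/groth_class_eqP; exists (h z); rewrite -!raddfD e.
Qed.

Lemma groth_map_zmod_morphism : zmod_morphism groth_map.
Proof.
move=> x y; have [a [b ->]] := groth_classP x.
have [c [d ->]] := groth_classP y.
by rewrite groth_classN groth_classD !groth_mapE groth_classN groth_classD
           !raddfD.
Qed.

HB.instance Definition _ :=
  GRing.isZmodMorphism.Build _ _ groth_map groth_map_zmod_morphism.

End GrothendieckMap.

Definition K0n (n : nat) (n_gt1 : (1 < n)%N) (R : pzRingType) : zmodType :=
  grothendieck (Vmonoid n_gt1 R).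

Definition K0n_map (n : nat) (n_gt1 : (1 < n)%N) (R S : pzRingType)
    (alpha : {rmorphism R -> S}) : {additive K0n n_gt1 R -> K0n n_gt1 S} :=
  groth_map (@V_map n n_gt1 R S alpha).

Lemma K0n_mapE (n : nat) (n_gt1 : (1 < n)%N) (R S : pzRingType)
    (alpha : {rmorphism R -> S}) (x y : Vmonoid n_gt1 R) :
  K0n_map n_gt1 alpha (groth_class x y) =
  groth_class (V_map alpha x) (V_map alpha y).
Proof. exact: groth_mapE. Qed.

Lemma K0n_map_comp (n : nat) (n_gt1 : (1 < n)%N) (R S T : pzRingType)
    (alpha : {rmorphism R -> S}) (beta : {rmorphism S -> T})
    (gamma : {rmorphism R -> T}) (x : K0n n_gt1 R) :
  (forall r, beta (alpha r) = gamma r) ->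
  K0n_map n_gt1 beta (K0n_map n_gt1 alpha x) = K0n_map n_gt1 gamma x.
Proof.
move=> abc; have Vcomp (v : Vmonoid n_gt1 R) :
    V_map beta (V_map alpha v) = V_map gamma v.
  rewrite -[v]VclassK !V_mapE; apply/Vclass_eqP.
  set g := npot_map gamma _.
  suff -> : npot_mx (npot_map beta (npot_map alpha (repr v))) = npot_mx g.
    by apply: (rsim_refl n_gt1); exact: (eqP (npot_mxP g)).
  by apply/matrixP => i j; rewrite !mxE.
by have [u [v ->]] := groth_classP x; rewrite (K0n_mapE alpha) !K0n_mapE !Vcomp.
Qed.

Section Kernel.
Variables (U V : zmodType) (h : {additive U -> V}).

Definition ker_pred : {pred U} := fun x => h x == 0.

Lemma ker_zmod_closed : zmod_closed ker_pred.
Proof.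
split=> [|x y]; rewrite !unfold_in ?raddf0 // => /eqP hx /eqP hy.
by rewrite raddfB hx hy subr0.
Qed.

HB.instance Definition _ := GRing.isZmodClosed.Build U ker_pred ker_zmod_closed.

Definition ker_type := {x : U | x \in ker_pred}.

HB.instance Definition _ := SubChoice.on ker_type.
HB.instance Definition _ := [SubChoice_isSubZmodule of ker_type by <:].

End Kernel.

Section KernelMap.
Variables (U V U' V' : zmodType).
Variables (h : {additive U -> V}) (h' : {additive U' -> V'}).
Variables (u : {additive U -> U'}) (v : {additive V -> V'}).
Hypothesis huv : forall x, h' (u x) = v (h x).

Fact ker_map_subproof (x : ker_type h) : u (val x) \in ker_pred h'.
Proof. by rewrite unfold_in huv (eqP (valP x)) raddf0. Qed.

Definition ker_map (x : ker_type h) : ker_type h' :=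
  exist _ (u (val x)) (ker_map_subproof x).

Lemma ker_map_zmod_morphism : zmod_morphism ker_map.
Proof. by move=> x y; apply: val_inj; rewrite /= raddfB. Qed.

HB.instance Definition _ :=
  GRing.isZmodMorphism.Build _ _ ker_map ker_map_zmod_morphism.

End KernelMap.

HB.mixin Record Lmodule_isNUAlgebra (F : fieldType) A of GRing.Lmodule F A := {
  nmul : A -> A -> A;
  nmulA : associative nmul;
  nmulDl : left_distributive nmul +%R;
  nmulDr : right_distributive nmul +%R;
  nscaleAl : forall (c : F) (x y : A), c *: nmul x y = nmul (c *: x) y;
  nscaleAr : forall (c : F) (x y : A), c *: nmul x y = nmul x (c *: y)
}.

#[short(type="nualgType")]
HB.structure Definition NUAlgebra (F : fieldType) :=
  {A of Lmodule_isNUAlgebra F A & GRing.Lmodule F A}.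

Record nualg_hom (F : fieldType) (A B : nualgType F) := NUAlgHom {
  nualg_fun :> {linear A -> B};
  nualg_funM : forall x y, nualg_fun (nmul x y) = nmul (nualg_fun x) (nualg_fun y)
}.

Section Unitization.
Variables (F : fieldType) (A : nualgType F).

Definition unitization := (A * F)%type.

HB.instance Definition _ := GRing.Lmodule.copy unitization (A * F^o)%type.

Definition unitization_one : unitization := (0, 1).

(* (a, r)(b, s) = (ab + as + br, rs), with scalars written on the left *)
Definition unitization_mul (x y : unitization) : unitization :=
  (nmul x.1 y.1 + y.2 *: x.1 + x.2 *: y.1, x.2 * y.2).

Lemma nmul0 (x : A) : nmul 0 x = 0.
Proof. by rewrite -[0 in LHS](scale0r (0 : A)) -nscaleAl scale0r. Qed.

Lemma nmulx0 (x : A) : nmul x 0 = 0.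
Proof. by rewrite -[0 in LHS](scale0r (0 : A)) -nscaleAr scale0r. Qed.

Lemma unitization_mulA : associative unitization_mul.
Proof.
case=> [a r] [b s] [c t]; rewrite /unitization_mul /=.
congr pair; last exact: mulrA.
rewrite !nmulDl !nmulDr !scalerDr -!nscaleAl -!nscaleAr !nmulA !scalerA.
by rewrite [s * t]mulrC [r * t]mulrC [LHS](AC (4*3) ((1*3*5)*(2*4*6)*7)).
Qed.

Lemma unitization_mul1x : left_id unitization_one unitization_mul.
Proof.
case=> [b s]; rewrite /unitization_mul /= nmul0 scaler0 scale1r mul1r.
by rewrite !add0r.
Qed.

Lemma unitization_mulx1 : right_id unitization_one unitization_mul.
Proof.
case=> [b s]; rewrite /unitization_mul /= nmulx0 scaler0 scale1r mulr1.
by rewrite addr0 add0r.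
Qed.

Lemma unitization_mulDl : left_distributive unitization_mul +%R.
Proof.
case=> [a r] [b s] [c t]; rewrite /unitization_mul /=.
congr pair; last exact: mulrDl.
by rewrite /= nmulDl scalerDr scalerDl [LHS](AC (2*2*2) ((1*3*5)*(2*4*6))).
Qed.

Lemma unitization_mulDr : right_distributive unitization_mul +%R.
Proof.
case=> [a r] [b s] [c t]; rewrite /unitization_mul /=.
congr pair; last exact: mulrDr.
by rewrite /= nmulDr scalerDr scalerDl [LHS](AC (2*2*2) ((1*3*5)*(2*4*6))).
Qed.

Lemma unitization_one_neq0 : unitization_one != 0.
Proof. by apply/eqP => -[/eqP]; rewrite oner_eq0. Qed.

HB.instance Definition _ := GRing.Zmodule_isNzRing.Build unitization
  unitization_mulA unitization_mul1x unitization_mulx1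
  unitization_mulDl unitization_mulDr unitization_one_neq0.

Lemma unitization_scaleAl (c : F) (x y : unitization) :
  c *: (x * y) = (c *: x) * y.
Proof.
case: x y => [a r] [b s]; congr pair; last exact: mulrA.
by rewrite /= !scalerDr nscaleAl !scalerA [s * c]mulrC.
Qed.

Lemma unitization_scaleAr (c : F) (x y : unitization) :
  c *: (x * y) = x * (c *: y).
Proof.
case: x y => [a r] [b s]; congr pair; last exact: mulrCA.
by rewrite /= !scalerDr nscaleAr !scalerA [r * c]mulrC.
Qed.

HB.instance Definition _ :=
  GRing.Lmodule_isLalgebra.Build F unitization unitization_scaleAl.
HB.instance Definition _ :=
  GRing.Lalgebra_isAlgebra.Build F unitization unitization_scaleAr.

Definition unitization_proj (x : unitization) : F := x.2.

Lemma unitization_proj_zmod_morphism : zmod_morphism unitization_proj.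
Proof. by []. Qed.

Lemma unitization_proj_monoid_morphism : monoid_morphism unitization_proj.
Proof. by []. Qed.

HB.instance Definition _ := GRing.isZmodMorphism.Build _ _ unitization_proj
  unitization_proj_zmod_morphism.
HB.instance Definition _ := GRing.isMonoidMorphism.Build _ _ unitization_proj
  unitization_proj_monoid_morphism.

End Unitization.

Section UnitizationMap.
Variables (F : fieldType) (A B : nualgType F) (f : nualg_hom A B).

Definition unitization_map (x : unitization A) : unitization B := (f x.1, x.2).

Lemma unitization_map_zmod_morphism : zmod_morphism unitization_map.
Proof. by case=> [a r] [b s]; congr pair; rewrite /= raddfB. Qed.

Lemma unitization_map_monoid_morphism : monoid_morphism unitization_map.
Proof.
split=> [|[a r] [b s]]; first by congr pair; rewrite /= raddf0.
by congr pair; rewrite /= !raddfD /= nualg_funM !linearZ.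
Qed.

HB.instance Definition _ := GRing.isZmodMorphism.Build _ _ unitization_map
  unitization_map_zmod_morphism.
HB.instance Definition _ := GRing.isMonoidMorphism.Build _ _ unitization_map
  unitization_map_monoid_morphism.

End UnitizationMap.

Section NonUnitalK.
Variables (n : nat) (n_gt1 : (1 < n)%N) (F : fieldType).

(* The kernel is taken on the unitization of every A, including those that
   have a unit. *)
Definition K0n_alg (A : nualgType F) : zmodType :=
  ker_type (K0n_map n_gt1 (@unitization_proj F A)).

Fact K0n_alg_map_subproof (A B : nualgType F) (f : nualg_hom A B)
    (x : K0n n_gt1 (unitization A)) :
  K0n_map n_gt1 (@unitization_proj F B) (K0n_map n_gt1 (unitization_map f) x) =
  idfun (K0n_map n_gt1 (@unitization_proj F A) x).
Proof.
by apply: K0n_map_comp.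
Qed.

Definition K0n_alg_map (A B : nualgType F) (f : nualg_hom A B) :
    {additive K0n_alg A -> K0n_alg B} :=
  ker_map (K0n_alg_map_subproof f).

End NonUnitalK.

(* Idempotents are the 2-potents, so K_0 is K_0^2. *)
Definition K0_alg (F : fieldType) (A : nualgType F) : zmodType :=
  K0n_alg (leqnn 2) A.

Definition K0_alg_map (F : fieldType) (A B : nualgType F) (f : nualg_hom A B) :
    {additive K0_alg A -> K0_alg B} :=
  K0n_alg_map (leqnn 2) f.

(* Main.v *)
From HB Require Import structures.
Require Import Defs.
From mathcomp Require Import all_boot all_order all_algebra.
From mathcomp Require Import complex.
From mathcomp Require Import reals trigo.


(** Put m = n - 1 and let w be the primitive m-th root of unity of the
cyclotomic field F. An n-potent e satisfies the separable equation
x (x ^ m - 1) = 0, so it is diagonalizable over F with eigenvalues in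
{0, 1, w, ..., w ^ (m - 1)}: for i < m,
  e_i = 1/m (sum over 1 <= l <= m of w ^ (- i l) e ^ l)
is the idempotent projecting onto the eigenspace of w ^ i; the e_i are pairwise
orthogonal and e is the sum of the w ^ i e_i ([spectral_orth], [spectral_sum]).
The isomorphism sends [e] to ([e_0], ..., [e_(m-1)]), and its inverse sends a
family ([p_i]) of classes of idempotents to the sum of the [w ^ i p_i].

Both maps apply to a matrix a polynomial without constant term whose
coefficients are central scalars. Such an operation respects the relation
e = a b, f = b a, because (a b) ^ (l + 1) = a c and (b a) ^ (l + 1) = c a for
c = (b a) ^ l b ([rsim_powsum]); it commutes with block-diagonal sums and with
ring homomorphisms fixing the scalars. So it induces additive maps of the monoids
of classes and of their Grothendieck groups, natural in the ring
([K0n_powsum_natural]).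

The two maps are mutually inverse: the j-th spectral part of w ^ i p is p when
i = j and 0 otherwise ([spectral_twist]), while the sum of the [w ^ i e_i] is
[e] because the class of a sum of pairwise orthogonal n-potents is the sum of
their classes ([Vclass_orth_sum]). Everything is done for an arbitrary ring with
central scalars from F; naturality with respect to the projection of the
unitization of A onto F restricts the isomorphism to the kernels that define the
K-groups of A, and naturality with respect to the homomorphisms induced by
A -> B gives naturality in A. *)

Set Implicit Arguments.
Unset Strict Implicit.
Unset Printing Implicit Defensive.

Import Order.TTheory GRing.Theory Num.Theory.
Local Open Scope ring_scope.

(** * A primitive root of unity in the cyclotomic field *)

Section RootOfUnity.
Variable R : realType.

Lemma complex_exp_angle (x : R) k :
  Complex (cos x) (sin x) ^+ k = Complex (cos (x *+ k)) (sin (x *+ k)).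
Proof.
elim: k => [|k IH]; first by rewrite expr0 mulr0n cos0 sin0.
rewrite exprS IH mulrS cosD sinD.
by apply/eqP; rewrite eq_complex /= eqxx [cos x * sin _ + _]addrC eqxx.
Qed.

(** By the half-angle formula 1 - cos x = 2 sin (x / 2) ^ 2, and the sine is
positive on the open interval from 0 to pi. *)
Lemma cos_neq1 (x : R) : 0 < x < pi *+ 2 -> cos x != 1.
Proof.
move=> /andP[x0 x2].
have : 0 < sin (x / 2).
  apply: sin_gt0_pi; rewrite divr_gt0 //= ltr_pdivrMr //.
  by rewrite mulr_natr.
move=> s0; have -> : x = (x / 2) *+ 2 by rewrite -mulr_natr divfK ?pnatr_eq0.
rewrite cos_mulr2n; have := cos2Dsin2 (x / 2).
move: s0; move: (sin _) (cos _) => s c s0 cs.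
have -> : c ^+ 2 *+ 2 - 1 = 1 - s ^+ 2 *+ 2.
  by rewrite -(addrK (s ^+ 2) (c ^+ 2)) cs mulrnBl addrAC mulr2n addrK.
by rewrite lt_eqF // ltrBlDr ltrDl pmulrn_lgt0 ?exprn_gt0.
Qed.

Lemma root_of_unity_prim m :
  (0 < m)%N -> m.-primitive_root (Defs.root_of_unity R m).
Proof.
move=> m0; have m0R : 0 < m%:R :> R by rewrite ltr0n.
have angleM k : 2 * pi / m%:R *+ k = pi *+ 2 * (k%:R / m%:R) :> R.
  by rewrite -[LHS]mulr_natr -[pi *+ 2]mulr_natr [2 * pi]mulrC !mulrA
    [_ * k%:R / _]mulrAC.
apply/andP; split=> //; apply/forallP => i; rewrite unity_rootE.
rewrite /Defs.root_of_unity complex_exp_angle; apply/eqP.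
have [->|neq] := eqVneq i.+1 m.
  by rewrite angleM (divff (lt0r_neq0 m0R)) mulr1 cos2pi sin2pi; apply/eqP.
apply/negbTE; rewrite eq_complex /= negb_and cos_neq1 //.
have pi2 : 0 < pi *+ 2 :> R by rewrite pmulrn_lgt0 ?pi_gt0.
rewrite angleM pmulr_rgt0 // divr_gt0 ?ltr0n //=.
rewrite -[ltRHS]mulr1 ltr_pM2l // ltr_pdivrMr //.
by rewrite mul1r ltr_nat ltn_neqAle neq ltn_ord.
Qed.

Lemma root_of_unity_in_cyclotomic m : Defs.root_of_unity R m \in cyclotomic m.
Proof. by apply/boolp.asboolP. Qed.

Lemma cyclotomic_has_prim_root m :
  (0 < m)%N -> exists w : Qcyc R m, m.-primitive_root w.
Proof.
move=> m0.
exists (Sub (Defs.root_of_unity R m) (root_of_unity_in_cyclotomic m)).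
rewrite -(fmorph_primitive_root (val : Qcyc R m -> R[i])).
exact: root_of_unity_prim.
Qed.

End RootOfUnity.

(** * Polynomials without constant term, evaluated at matrices *)

(** Orthogonality of the characters of the cyclic group of order m. *)
Lemma sum_powers_unity_root (F : fieldType) m (v : F) : v ^+ m = 1 ->
  \sum_(l < m) v ^+ l = if v == 1 then m%:R else 0.
Proof.
move=> vm; have [->|v1] := eqVneq v 1.
  under eq_bigr do rewrite expr1n.
  by rewrite sumr_const card_ord.
have := subrX1 v m; rewrite vm subrr => /esym/eqP.
by rewrite mulf_eq0 subr_eq0 (negbTE v1) => /eqP.
Qed.

Section PowerSum.
Variables (F : fieldType) (R : pzRingType) (eta : {rmorphism F -> R}).

(** The value at e of the polynomial c_0 X + c_1 X ^ 2 + ... . A constant term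
would be incompatible both with enlarging a matrix by zeros and with the
equivalence of n-potents. *)
Definition powsum p (c : 'I_p -> F) k (e : 'M[R]_k) : 'M[R]_k :=
  \sum_(l < p) eta (c l) *: e ^+ l.+1.

Lemma powsum_block p (c : 'I_p -> F) k l (e : 'M[R]_k) (f : 'M[R]_l) :
  powsum c (block_mx e 0 0 f) = block_mx (powsum c e) 0 0 (powsum c f).
Proof.
rewrite /powsum; elim/big_rec3: _ => [|i x y z _ ->].
  by rewrite block_mx0.
by rewrite expmx_diag scale_block_mx add_block_mx !scaler0 !addr0.
Qed.

Lemma powsum0 p (c : 'I_p -> F) k : powsum c (0 : 'M[R]_k) = 0.
Proof. by rewrite /powsum big1 // => i _; rewrite exprS mul0r scaler0. Qed.

Hypothesis eta_comm : forall c x, eta c * x = x * eta c.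

Lemma central_scalemxAr c k l p (A : 'M[R]_(k, l)) (B : 'M[R]_(l, p)) :
  A *m (eta c *: B) = eta c *: (A *m B).
Proof.
apply/matrixP => i j; rewrite !mxE big_distrr /=; apply: eq_bigr => s _.
by rewrite !mxE !mulrA eta_comm.
Qed.

(** Since (a b) ^ (l + 1) = a ((b a) ^ l b), the left factor a can be kept and
the polynomial absorbed into the right factor. *)
Lemma rsim_powsum p (c : 'I_p -> F) k l (e : 'M[R]_k) (f : 'M[R]_l) :
  rsim e f -> rsim (powsum c e) (powsum c f).
Proof.
move=> [a [b [-> ->]]].
exists a, (\sum_(i < p) eta (c i) *: ((b *m a) ^+ i *m b)); split.
  rewrite mulmx_sumr; apply: eq_bigr => i _.
  by rewrite central_scalemxAr mulmxA mulmx_expC exprSr -mulmxE mulmxA.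
rewrite mulmx_suml; apply: eq_bigr => i _.
by rewrite -scalemxAl -mulmxA exprSr.
Qed.

(** The inverse isomorphism uses p |-> w ^ i p, which is a one-term polynomial. *)
Lemma powsum1E (u : F) k (e : 'M[R]_k) :
  powsum (fun _ : 'I_1 => u) e = eta u *: e.
Proof. by rewrite /powsum big_ord1 expr1. Qed.

Lemma exp_central_scale u k (e : 'M[R]_k) l :
  (eta u *: e) ^+ l = eta (u ^+ l) *: e ^+ l.
Proof.
elim: l => [|l IH]; first by rewrite !expr0 rmorph1 scale1r.
rewrite exprS IH -mulmxE -scalemxAl central_scalemxAr scalerA -rmorphM.
by rewrite mulmxE -!exprS.
Qed.

Lemma exp_eigen u k (e x : 'M[R]_k) l :
  e * x = eta u *: x -> e ^+ l * x = eta (u ^+ l) *: x.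
Proof.
move=> ex; elim: l => [|l IH]; first by rewrite !expr0 mul1r rmorph1 scale1r.
rewrite exprSr -mulrA ex -mulmxE central_scalemxAr mulmxE IH scalerA.
by rewrite -rmorphM -exprS.
Qed.

End PowerSum.

(** * Spectral idempotents of an n-potent *)

Section SpectralParts.
Variables (F : fieldType) (m : nat) (w : F).
Hypothesis w_prim : m.-primitive_root w.

(** Coefficients of the Lagrange polynomial of degree m that vanishes at 0 and
at every power w ^ j except w ^ i, where it takes the value 1. *)
Definition spectral_coef (i l : 'I_m) : F := (w ^+ i)^-1 ^+ l.+1 / m%:R.

Let m_neq0 : m%:R != 0 :> F := prim_root_natf_neq0 w_prim.
Let w_expm i : (w ^+ i) ^+ m = 1.
Proof. by rewrite exprAC (prim_expr_order w_prim) expr1n. Qed.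
Let w_exp_neq0 i : w ^+ i != 0.
Proof.
rewrite expf_neq0 // (prim_root_eq0 w_prim).
by rewrite -lt0n (prim_order_gt0 w_prim).
Qed.

Let w_exp_eq (i j : 'I_m) : (w ^+ i == w ^+ j) = (i == j).
Proof. by rewrite (eq_prim_root_expr w_prim) !modn_small ?ltn_ord. Qed.

(** The j-th Lagrange polynomial takes the value 1 or 0 at w ^ i according as
i = j or not. *)
Lemma spectral_coef_eigen (i j : 'I_m) :
  \sum_(l < m) spectral_coef j l * (w ^+ i) ^+ l.+1 = (i == j)%:R.
Proof.
set v := w ^+ i / w ^+ j.
have vm : v ^+ m = 1 by rewrite exprMn exprVn !w_expm invr1 mulr1.
transitivity (v * (\sum_(l < m) v ^+ l) / m%:R).
  rewrite big_distrr big_distrl /=; apply: eq_bigr => l _.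
  by rewrite -exprS /v exprMn /spectral_coef mulrAC [_ * (w ^+ i) ^+ _]mulrC.
rewrite sum_powers_unity_root // -w_exp_eq -subr_eq0.
have -> : (v - 1 == 0) = (w ^+ i == w ^+ j).
  by rewrite subr_eq0 -[RHS](inj_eq (mulIf (invr_neq0 (w_exp_neq0 j)))) divff.
case: eqP => [E|_]; last by rewrite mulr0 mul0r.
by rewrite /v E divff // mul1r divff.
Qed.

(** Coefficientwise form of the interpolation identity: the Lagrange
polynomials, weighted by the values w ^ i, add up to X. *)
Lemma spectral_coef_sum (l : 'I_m) :
  \sum_(i < m) w ^+ i * spectral_coef i l = (l == 0 :> nat)%:R.
Proof.
set v := w^-1 ^+ l; have vm : v ^+ m = 1.
  by rewrite exprAC exprVn (prim_expr_order w_prim) invr1 expr1n.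
transitivity ((\sum_(i < m) v ^+ i) / m%:R).
  rewrite big_distrl /=; apply: eq_bigr => i _.
  rewrite /spectral_coef exprS !mulrA divff ?w_exp_neq0 // mul1r.
  by rewrite -exprVn exprAC.
rewrite sum_powers_unity_root //.
have -> : (v == 1) = (l == 0 :> nat).
  rewrite /v exprVn invr_eq1.
  rewrite -[X in _ == X](expr0 w) (eq_prim_root_expr w_prim) mod0n.
  by rewrite modn_small.
by case: eqP => _; rewrite ?mul0r ?divff.
Qed.

Variables (R : pzRingType) (eta : {rmorphism F -> R}).
Hypothesis eta_comm : forall c x, eta c * x = x * eta c.

Notation spectral i := (powsum eta (spectral_coef i)).

(** Multiplication by e shifts the coefficients cyclically, because
e ^ (m + 1) = e, and a cyclic shift multiplies them by w ^ i. *)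
Lemma spectral_eigen (i : 'I_m) k (e : 'M[R]_k) : e ^+ m.+1 = e ->
  e * spectral i e = eta (w ^+ i) *: spectral i e.
Proof.
move=> eP; pose t l := eta ((w ^+ i)^-1 ^+ l / m%:R) *: e ^+ l.+1.
have -> : eta (w ^+ i) *: spectral i e = \sum_(l < m) t l.
  rewrite scaler_sumr; apply: eq_bigr => l _.
  by rewrite scalerA -rmorphM /spectral_coef exprS !mulrA divff // mul1r.
have -> : e * spectral i e = \sum_(l < m) t l.+1.
  rewrite mulr_sumr; apply: eq_bigr => l _.
  by rewrite -mulmxE (central_scalemxAr eta_comm) mulmxE -exprS.
have t0m : t 0 = t m.
  by rewrite /t [_ ^+ m]exprVn w_expm eP invr1 expr0 expr1.
(* Both sides, completed by t 0 = t m, are the sum of t 0, ..., t m. *)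
apply: (addrI (t 0)); rewrite [LHS](_ : _ = \sum_(l < m.+1) t l).
  by rewrite big_ord_recr /= addrC t0m.
by rewrite big_ord_recl.
Qed.

(** The j-th spectral part of e is a polynomial in e, so it acts on the
eigenspace of w ^ i by the scalar of [spectral_coef_eigen]. *)
Lemma spectral_orth (i j : 'I_m) k (e : 'M[R]_k) : e ^+ m.+1 = e ->
  spectral j e * spectral i e = if i == j then spectral i e else 0.
Proof.
move=> eP; rewrite {1}/powsum mulr_suml.
under eq_bigr => l _.
  rewrite -mulmxE -scalemxAl mulmxE.
  rewrite (exp_eigen eta_comm _ (spectral_eigen i eP)) scalerA -rmorphM.
  over.
rewrite -scaler_suml -rmorph_sum spectral_coef_eigen.
by case: eqP; rewrite ?rmorph1 ?rmorph0 ?scale1r ?scale0r.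
Qed.

Lemma spectral_idem (i : 'I_m) k (e : 'M[R]_k) : e ^+ m.+1 = e ->
  spectral i e ^+ 2 = spectral i e.
Proof. by move=> eP; rewrite expr2 spectral_orth // eqxx. Qed.

Lemma spectral_sum k (e : 'M[R]_k) :
  \sum_(i < m) eta (w ^+ i) *: spectral i e = e.
Proof.
under eq_bigr do rewrite scaler_sumr.
rewrite exchange_big /=.
under eq_bigr => l _.
  under eq_bigr do rewrite scalerA -rmorphM.
  rewrite -scaler_suml -rmorph_sum spectral_coef_sum.
  over.
rewrite -[RHS]expr1.
rewrite (bigD1 (Ordinal (prim_order_gt0 w_prim))) //= rmorph1 scale1r.
rewrite big1 ?addr0 // => l; rewrite -val_eqE /= => /negbTE ->.
by rewrite rmorph0 scale0r.
Qed.

Lemma idem_expS k (p : 'M[R]_k) l : p ^+ 2 = p -> p ^+ l.+1 = p.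
Proof.
by move=> pP; elim: l => // l IH; rewrite exprS IH -expr2 pP.
Qed.

Lemma twist_potent (i : 'I_m) k (p : 'M[R]_k) : p ^+ 2 = p ->
  powsum eta (fun _ : 'I_1 => w ^+ i) p ^+ m.+1
  = powsum eta (fun _ : 'I_1 => w ^+ i) p.
Proof.
move=> pP; rewrite powsum1E (exp_central_scale eta_comm) idem_expS //.
by rewrite exprS w_expm mulr1.
Qed.

Lemma spectral_twist (i j : 'I_m) k (p : 'M[R]_k) : p ^+ 2 = p ->
  spectral j (powsum eta (fun _ : 'I_1 => w ^+ i) p)
  = if i == j then p else 0.
Proof.
move=> pP; rewrite powsum1E /powsum.
under eq_bigr => l _.
  rewrite (exp_central_scale eta_comm) idem_expS // scalerA -rmorphM.
  over.
rewrite -scaler_suml -rmorph_sum spectral_coef_eigen.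
by case: eqP; rewrite ?rmorph1 ?rmorph0 ?scale1r ?scale0r.
Qed.

End SpectralParts.

(** * Sums of orthogonal potents *)

Section OrthogonalSums.
Variables (n : nat) (n_gt1 : (1 < n)%N) (R : pzRingType) (k : nat).

Lemma expr_orth_add (e f : 'M[R]_k) l : e * f = 0 -> f * e = 0 ->
  (e + f) ^+ l.+1 = e ^+ l.+1 + f ^+ l.+1.
Proof.
move=> ef fe; elim: l => [|l IH]; first by rewrite !expr1.
have efl : e * f ^+ l.+1 = 0 by rewrite exprS mulrA ef mul0r.
have fel : f * e ^+ l.+1 = 0 by rewrite exprS mulrA fe mul0r.
by rewrite exprS IH mulrDl !mulrDr efl fel addr0 add0r -!exprS.
Qed.

(** Factor e + f = e ^ n + f ^ n as the row (e, f) times the column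
(e ^ (n - 1), f ^ (n - 1)); the product in the other order is diag(e, f), its
off-diagonal blocks vanishing by orthogonality. *)
Lemma rsim_orth_add (e f : 'M[R]_k) :
  e ^+ n = e -> f ^+ n = f -> e * f = 0 -> f * e = 0 ->
  rsim (block_mx e 0 0 f) (e + f).
Proof.
case: n n_gt1 => [|[|l]] // _ eP fP ef fe; apply: rsim_sym.
exists (row_mx e f), (col_mx (e ^+ l.+1) (f ^+ l.+1)); split.
  by rewrite mul_row_col !mulmxE -!exprS eP fP.
rewrite mul_col_row !mulmxE -!exprSr eP fP.
by rewrite !exprSr -!mulrA ef fe !mulr0.
Qed.

(** The conclusion is existential because the sum being n-potent, itself a
consequence of orthogonality, is part of the data of its class. *)
Lemma Vclass_orth_sum (I : finType) (q : I -> 'M[R]_k)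
    (qP : forall i, q i ^+ n == q i) :
  (forall i j, i != j -> q i * q j = 0) ->
  exists H : (\sum_i q i) ^+ n == \sum_i q i,
    \sum_i Vclass n_gt1 (Npotent (qP i)) = Vclass n_gt1 (Npotent H).
Proof.
move=> orth; elim: (index_enum I) (index_enum_uniq I) => [_|a r IH].
  have H : (\sum_(i <- [::]) q i) ^+ n == \sum_(i <- [::]) q i.
    by rewrite big_nil expr0n_gt1.
  exists H; rewrite big_nil Vclass0; apply/Vclass_eqP; rewrite /npot_mx /=.
  by rewrite big_nil; exists 0, 0; rewrite !mulmx0.
move=> /= /andP[ar /IH [Hr E]].
have ort i : i \in r -> q a * q i = 0 /\ q i * q a = 0.
  move=> ir; split; apply: orth;
    by apply: contraNneq ar => ai; rewrite ?ai // -ai.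
have o1 : q a * (\sum_(i <- r) q i) = 0.
  by rewrite mulr_sumr big_seq big1 // => i /ort[].
have o2 : (\sum_(i <- r) q i) * q a = 0.
  by rewrite mulr_suml big_seq big1 // => i /ort[].
have H : (\sum_(i <- a :: r) q i) ^+ n == \sum_(i <- a :: r) q i.
  rewrite big_cons; case: n n_gt1 qP Hr {E IH} => // l _ qP Hr.
  by rewrite expr_orth_add // (eqP (qP a)) (eqP Hr).
exists H; rewrite big_cons E VclassD; apply/Vclass_eqP; rewrite /npot_mx /=.
rewrite big_cons; exact: (rsim_orth_add (eqP (qP a)) (eqP Hr) o1 o2).
Qed.

End OrthogonalSums.

(** * Maps of K-groups induced by such polynomials *)

Section InducedMaps.
Variables (n n' : nat) (n_gt1 : (1 < n)%N) (n'_gt1 : (1 < n')%N).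
Variables (F : fieldType) (p : nat) (c : 'I_p -> F).

Section OneRing.
Variables (R : pzRingType) (eta : {rmorphism F -> R}).
Hypothesis eta_comm : forall c x, eta c * x = x * eta c.
Hypothesis potP : forall k (e : 'M[R]_k),
  e ^+ n = e -> powsum eta c e ^+ n' = powsum eta c e.

Fact npot_powsum_subproof (e : npotent n R) :
  powsum eta c (npot_mx e) ^+ n' == powsum eta c (npot_mx e).
Proof. by apply/eqP/potP/eqP/npot_mxP. Qed.

Definition npot_powsum (e : npotent n R) : npotent n' R :=
  Npotent (npot_powsum_subproof e).

Definition V_powsum_fun (x : Vmonoid n_gt1 R) : Vmonoid n'_gt1 R :=
  Vclass n'_gt1 (npot_powsum (repr x)).

Lemma V_powsum_funE e :
  V_powsum_fun (Vclass n_gt1 e) = Vclass n'_gt1 (npot_powsum e).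
Proof.
by apply/Vclass_eqP/(rsim_powsum eta_comm)/(Vclass_eqP n_gt1)/VclassK.
Qed.

Lemma V_powsum_nmod_morphism : nmod_morphism V_powsum_fun.
Proof.
split=> [|x y].
  rewrite Vclass0 V_powsum_funE; apply/Vclass_eqP.
  rewrite /= /npot_mx /= powsum0.
  exact/(rsim_refl n'_gt1)/expr0n_gt1.
rewrite -[x]VclassK -[y]VclassK VclassD !V_powsum_funE VclassD.
apply/Vclass_eqP; rewrite /npot_mx /= powsum_block.
by apply: (rsim_refl n'_gt1); apply: diag_npot; apply/eqP/npot_powsum_subproof.
Qed.

Definition V_powsum : {additive Vmonoid n_gt1 R -> Vmonoid n'_gt1 R} :=
  HB.pack V_powsum_fun
    (GRing.isNmodMorphism.Build _ _ V_powsum_fun V_powsum_nmod_morphism).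

Lemma V_powsumE e : V_powsum (Vclass n_gt1 e) = Vclass n'_gt1 (npot_powsum e).
Proof. exact: V_powsum_funE. Qed.

Definition K0n_powsum : {additive K0n n_gt1 R -> K0n n'_gt1 R} :=
  groth_map V_powsum.

Lemma K0n_powsumE a b :
  K0n_powsum (groth_class a b) = groth_class (V_powsum a) (V_powsum b).
Proof. exact: groth_mapE. Qed.

End OneRing.

Arguments V_powsum {R eta}.
Arguments K0n_powsum {R eta}.

Section Naturality.
Variables (R S : pzRingType) (alpha : {rmorphism R -> S}).
Variables (etaR : {rmorphism F -> R}) (etaS : {rmorphism F -> S}).
Hypothesis alpha_eta : forall x, alpha (etaR x) = etaS x.

Lemma map_powsum k (e : 'M[R]_k) :
  map_mx alpha (powsum etaR c e) = powsum etaS c (map_mx alpha e).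
Proof.
rewrite /powsum raddf_sum; apply: eq_bigr => l _.
by rewrite /= map_mxZ map_mx_exp alpha_eta.
Qed.

Variables (commR : forall c x, etaR c * x = x * etaR c).
Variables (commS : forall c x, etaS c * x = x * etaS c).
Variables (potR : forall k (e : 'M[R]_k),
  e ^+ n = e -> powsum etaR c e ^+ n' = powsum etaR c e).
Variables (potS : forall k (e : 'M[S]_k),
  e ^+ n = e -> powsum etaS c e ^+ n' = powsum etaS c e).

Lemma V_powsum_natural x :
  V_map alpha (V_powsum commR potR x) = V_powsum commS potS (V_map alpha x).
Proof.
rewrite -[x]VclassK V_powsumE !V_mapE V_powsumE.
apply/Vclass_eqP; rewrite /npot_mx /= map_powsum.
by apply/(rsim_refl n'_gt1)/potS/eqP/npot_map_subproof.
Qed.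

Lemma K0n_powsum_natural x :
  K0n_map n'_gt1 alpha (K0n_powsum commR potR x)
  = K0n_powsum commS potS (K0n_map n_gt1 alpha x).
Proof.
have [u [v ->]] := groth_classP x.
rewrite K0n_powsumE (K0n_mapE alpha) (K0n_mapE alpha) K0n_powsumE.
by rewrite !V_powsum_natural.
Qed.

End Naturality.
End InducedMaps.

Arguments V_powsum {n n'} n_gt1 n'_gt1 {F p c R eta}.
Arguments K0n_powsum {n n'} n_gt1 n'_gt1 {F p c R eta}.

(** * The isomorphism for rings with central scalars *)

Lemma groth_class_sum (M : nmodType) (I : finType) (a b : I -> M) :
  \sum_i groth_class (a i) (b i) = groth_class (\sum_i a i) (\sum_i b i).
Proof.
elim/big_rec3: _ => [|i x y z _ ->]; first by rewrite groth_class0.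
by rewrite groth_classD.
Qed.

Section UnitalIsomorphism.
Variables (F : fieldType) (m : nat) (w : F).
Hypothesis w_prim : m.-primitive_root w.
Variable (n_gt1 : (1 < m.+1)%N).
Variables (R : pzRingType) (eta : {rmorphism F -> R}).
Hypothesis eta_comm : forall c x, eta c * x = x * eta c.

Definition V_spectral (i : 'I_m) :
    {additive Vmonoid n_gt1 R -> Vmonoid (leqnn 2) R} :=
  V_powsum n_gt1 (leqnn 2) eta_comm (spectral_idem w_prim eta_comm i).

Definition V_twist (i : 'I_m) :
    {additive Vmonoid (leqnn 2) R -> Vmonoid n_gt1 R} :=
  V_powsum (leqnn 2) n_gt1 eta_comm (twist_potent w_prim eta_comm i).

Definition K0n_spectral (i : 'I_m) :
    {additive K0n n_gt1 R -> K0n (leqnn 2) R} :=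
  K0n_powsum n_gt1 (leqnn 2) eta_comm (spectral_idem w_prim eta_comm i).

Definition K0n_twist (i : 'I_m) :
    {additive K0n (leqnn 2) R -> K0n n_gt1 R} :=
  K0n_powsum (leqnn 2) n_gt1 eta_comm (twist_potent w_prim eta_comm i).

Lemma V_spectral_twist i j x :
  V_spectral j (V_twist i x) = if i == j then x else 0.
Proof.
rewrite -[x]VclassK /V_spectral /V_twist !V_powsumE Vclass0.
have idP := eqP (npot_mxP (repr x)).
case: eqP (spectral_twist w_prim eta_comm i j idP) => _ E;
  apply/Vclass_eqP; rewrite {1}/npot_mx /= E.
  exact: (rsim_refl (leqnn 2)).
by exists 0, 0; rewrite /npot_mx /= !mulmx0.
Qed.

(** The twisted spectral parts of e are pairwise orthogonal n-potents of sum e,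
so [Vclass_orth_sum] adds up their classes. *)
Lemma V_twist_spectral x : \sum_i V_twist i (V_spectral i x) = x.
Proof.
rewrite -[x]VclassK /V_spectral /V_twist.
set e := repr x; have eP := eqP (npot_mxP e).
pose q (i : 'I_m) := powsum eta (fun _ : 'I_1 => w ^+ i)
  (powsum eta (spectral_coef w i) (npot_mx e)).
have qP i : q i ^+ m.+1 == q i.
  by apply/eqP/(twist_potent w_prim eta_comm)/(spectral_idem w_prim eta_comm).
have orth i j : i != j -> q i * q j = 0.
  move=> /negbTE ij; rewrite /q !powsum1E -mulmxE -scalemxAl.
  rewrite (central_scalemxAr eta_comm) mulmxE.
  by rewrite (spectral_orth w_prim eta_comm) // eq_sym ij !scaler0.
have [H E] := Vclass_orth_sum n_gt1 qP orth.
transitivity (Vclass n_gt1 (Npotent H)).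
  rewrite -E; apply: eq_bigr => i _; rewrite !V_powsumE.
  by apply/Vclass_eqP/(rsim_refl n_gt1)/eqP/qP.
apply/Vclass_eqP; rewrite /npot_mx /=.
under eq_bigr do rewrite /q powsum1E.
rewrite (spectral_sum w_prim); exact: (rsim_refl n_gt1).
Qed.

Lemma K0n_spectral_twist i j x :
  K0n_spectral j (K0n_twist i x) = if i == j then x else 0.
Proof.
have [a [b ->]] := groth_classP x.
rewrite /K0n_spectral /K0n_twist !K0n_powsumE !V_spectral_twist.
by case: eqP.
Qed.

Lemma K0n_twist_spectral x : \sum_i K0n_twist i (K0n_spectral i x) = x.
Proof.
have [a [b ->]] := groth_classP x.
rewrite /K0n_spectral /K0n_twist.
under eq_bigr do rewrite !K0n_powsumE.
by rewrite groth_class_sum !V_twist_spectral.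
Qed.

End UnitalIsomorphism.

(** * The isomorphism for nonunital algebras *)

Section UnitizationScalars.
Variables (F : fieldType) (A : nualgType F).

Definition unit_scalar : {rmorphism F -> unitization A} :=
  GRing.in_alg (unitization A).

Lemma unit_scalar_comm c x : unit_scalar c * x = x * unit_scalar c.
Proof. by rewrite /unit_scalar /= mulr_algl mulr_algr. Qed.

Lemma unitization_proj_scalar c : unitization_proj (unit_scalar c) = c.
Proof. exact: mulr1. Qed.

End UnitizationScalars.

Lemma unitization_map_scalar (F : fieldType) (A B : nualgType F)
  (f : nualg_hom A B) c : unitization_map f (unit_scalar A c) = unit_scalar B c.
Proof. by congr pair; rewrite /= ?scaler0 ?raddf0. Qed.

Section NonUnitalIsomorphism.
Variables (F : fieldType) (m : nat) (w : F).
Hypothesis w_prim : m.-primitive_root w.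
Variable (n_gt1 : (1 < m.+1)%N).

Let field_comm (c x : F) : idfun c * x = x * idfun c.
Proof. exact: mulrC. Qed.

(** The two following compatibilities make the spectral and twist maps restrict
to the kernels of the maps induced by the projection A^+ -> F. *)
Fact K0n_spectral_proj (A : nualgType F) i x :
  K0n_map (leqnn 2) (@unitization_proj F A)
    (K0n_spectral w_prim n_gt1 (@unit_scalar_comm F A) i x)
  = K0n_spectral w_prim n_gt1 field_comm i
    (K0n_map n_gt1 (@unitization_proj F A) x).
Proof. exact/K0n_powsum_natural/unitization_proj_scalar. Qed.

Fact K0n_twist_proj (A : nualgType F) i x :
  K0n_map n_gt1 (@unitization_proj F A)
    (K0n_twist w_prim n_gt1 (@unit_scalar_comm F A) i x)
  = K0n_twist w_prim n_gt1 field_comm i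
    (K0n_map (leqnn 2) (@unitization_proj F A) x).
Proof. exact/K0n_powsum_natural/unitization_proj_scalar. Qed.

Definition K0n_alg_spectral (A : nualgType F) i :
    {additive K0n_alg n_gt1 A -> K0_alg A} :=
  ker_map (@K0n_spectral_proj A i).

Definition K0n_alg_twist (A : nualgType F) i :
    {additive K0_alg A -> K0n_alg n_gt1 A} :=
  ker_map (@K0n_twist_proj A i).

Definition K0n_alg_split (A : nualgType F) (x : K0n_alg n_gt1 A) :
    {ffun 'I_m -> K0_alg A} :=
  [ffun i => K0n_alg_spectral A i x].

Lemma K0n_alg_split_zmod_morphism A : zmod_morphism (@K0n_alg_split A).
Proof. by move=> x y; apply/ffunP => i; rewrite !ffunE raddfB. Qed.

HB.instance Definition _ A := GRing.isZmodMorphism.Build _ _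
  (@K0n_alg_split A) (@K0n_alg_split_zmod_morphism A).

Lemma K0n_alg_split_bij A : bijective (@K0n_alg_split A).
Proof.
exists (fun y : {ffun 'I_m -> K0_alg A} => \sum_i K0n_alg_twist A i (y i)).
  move=> x; apply: val_inj; rewrite raddf_sum /=.
  rewrite -[RHS](K0n_twist_spectral w_prim (@unit_scalar_comm F A)).
  by apply: eq_bigr => i _; rewrite ffunE.
move=> y; apply/ffunP => j; rewrite ffunE raddf_sum.
apply: val_inj; rewrite raddf_sum /= (bigD1 j) //=.
rewrite K0n_spectral_twist eqxx big1 ?addr0 // => i /negbTE ij.
by rewrite K0n_spectral_twist ij.
Qed.

Lemma K0n_alg_split_natural (A B : nualgType F) (f : nualg_hom A B) x i :
  K0n_alg_split (K0n_alg_map n_gt1 f x) i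
  = K0_alg_map f (K0n_alg_split x i).
Proof.
rewrite !ffunE; apply: val_inj; rewrite /=.
exact/esym/K0n_powsum_natural/unitization_map_scalar.
Qed.

End NonUnitalIsomorphism.

Theorem theorem3p13 (R : realType) (n : nat) (n_gt1 : (1 < n)%N) :
  exists phi : forall A : nualgType (Qcyc R (n - 1)),
      {additive K0n_alg n_gt1 A -> {ffun 'I_(n - 1) -> K0_alg A}},
    (forall A, bijective (phi A)) /\
    (forall (A B : nualgType (Qcyc R (n - 1))) (f : nualg_hom A B)
            (x : K0n_alg n_gt1 A) (i : 'I_(n - 1)),
        phi B (K0n_alg_map n_gt1 f x) i = K0_alg_map f (phi A x i)).
Proof.
case: n n_gt1 => [|[|m]] // n_gt1.
rewrite (_ : (m.+2 - 1)%N = m.+1) //.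
have [w w_prim] := cyclotomic_has_prim_root R (ltn0Sn m).
exists (fun A => @K0n_alg_split _ _ _ w_prim n_gt1 A); split=> [A|A B f x i].
  exact: K0n_alg_split_bij.
exact: K0n_alg_split_natural.
Qed.
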